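(* Let $S$ be a semigroup with exponent $n$. Then (i) the minimum degree of the enhanced power graph satisfies $\delta(\mathcal{P}_e(S)) = m - 1$, where $m = \min\{o(x) : x \in \mathcal{M}\}$; (ii) the independence number $\alpha(\mathcal{P}_e(S))$ is the number of maximal monogenic subsemigroups of $S$.
   Context: For $z \in S$, $\langle z \rangle = \{z^m : m \geq 1\}$ is the subsemigroup generated by $z$, and $o(z) = |\langle z \rangle|$ is the order of $z$. $S$ is of bounded exponent if there is a positive integer $n$ such that $x^n$ is idempotent for every $x \in S$ (the idempotent may depend on $x$); the exponent of $S$ is then the least such $n$. ''$S$ has exponent $n$'' means $S$ is of bounded exponent with exponent $n$. A maximal monogenic subsemigroup of $S$ is a monogenic subsemigroup (one of the form $\langle a \rangle$, $a \in S$) that is not properly contained in any other monogenic subsemigroup of $S$. $\mathcal{M} = \{a \in S : \langle a \rangle \text{ is a maximal monogenic subsemigroup of } S\}$. The enhanced power graph $\mathcal{P}_e(S)$ is the simple undirected graph with vertex set $S$ in which two distinct vertices $x, y$ are adjacent if and only if $x, y \in \langle z \rangle$ for some $z \in S$. The independence number $\alpha$ is the maximum cardinality of a set of pairwise non-adjacent vertices. *)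

(* Defs.v *)
From HB Require Import structures.
From mathcomp Require Import all_boot.
From mathcomp Require Import boolp classical_sets functions cardinality.

Set Implicit Arguments.
Unset Strict Implicit.
Unset Printing Implicit Defensive.

Local Open Scope classical_set_scope.
Local Open Scope card_scope.

(* A cardinal number is represented by any set having that cardinality (with
   `I_k for the natural number k), since the library has no type of cardinals.
   [is_min_card F X]: the minimum of the cardinalities of the members of F
   exists and is the cardinality of X; dually for [is_max_card]. *)
Definition is_min_card {T U : Type} (F : set (set T)) (X : set U) : Prop :=
  (exists2 A, F A & A #= X) /\ (forall A, F A -> X #<= A).

Definition is_max_card {T U : Type} (F : set (set T)) (X : set U) : Prop :=
  (exists2 A, F A & A #= X) /\ (forall A, F A -> A #<= X).

Record simple_graph (V : Type) : Type := SimpleGraph {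
  adj : V -> V -> Prop;
  adj_sym : forall x y, adj x y -> adj y x;
  adj_irrefl : forall x, ~ adj x x }.

Section Graph.
Variables (V : Type) (G : simple_graph V).

Definition neighbours (x : V) : set V := [set y | adj G x y].

Definition is_min_degree {U : Type} (X : set U) : Prop :=
  is_min_card (range neighbours) X.

Definition independent (A : set V) : Prop :=
  forall x y, A x -> A y -> x <> y -> ~ adj G x y.

Definition is_independence_number {U : Type} (X : set U) : Prop :=
  is_max_card independent X.

End Graph.

Section Semigroup.
Variable S : semigroupType.

(* The m-th power of x for m >= 1; a semigroup has no empty product, and the
   value at m = 0 is the junk value x. *)
Definition spow (x : S) (m : nat) : S := iterop m (@mul S) x x.

Definition idempotent_elt (e : S) : Prop := mul e e = e.

Definition has_exponent (n : nat) : Prop :=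
  [/\ 0 < n,
      forall x : S, idempotent_elt (spow x n)
    & forall k, 0 < k -> (forall x : S, idempotent_elt (spow x k)) -> n <= k].

(* The order o(z) is the cardinality of [cyc z]. *)
Definition cyc (z : S) : set S := [set spow z m | m in [set m | 0 < m]].

Definition monogenic (A : set S) : Prop := exists a, A = cyc a.

Definition maximal_monogenic (A : set S) : Prop :=
  monogenic A /\ forall B, monogenic B -> ~ A `<` B.

Definition maxgen : set S := [set a | maximal_monogenic (cyc a)].

Definition epg_adj (x y : S) : Prop :=
  x <> y /\ exists z, cyc z x /\ cyc z y.

Lemma epg_adj_sym x y : epg_adj x y -> epg_adj y x.
Proof. by move=> [xy [z [zx zy]]]; split; [exact/nesym | exists z]. Qed.

Lemma epg_adj_irrefl x : ~ epg_adj x x.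
Proof. by move=> []. Qed.

Definition enhanced_power_graph : simple_graph S :=
  SimpleGraph epg_adj_sym epg_adj_irrefl.

End Semigroup.

Arguments maximal_monogenic {S}.
Arguments is_min_degree {V} G {U} X.
Arguments is_independence_number {V} G {U} X.
Arguments maxgen S : clear implicits.
Arguments enhanced_power_graph S : clear implicits.

(* Main.v *)
(* In exponent n every monogenic subsemigroup is a subset of the 2n first
   powers of its generator, so these sizes are bounded and every element lies
   in a maximal monogenic subsemigroup.  Each maximal cyc a is a clique, the
   closed neighbourhood of each of its generators, and any pair of adjacent
   vertices shares one.  Hence degrees are smallest on maximal generators, and
   an independent set meets each maximal subsemigroup at most once while one
   generator from each of them gives an independent set. *)

Require Import Defs.
From HB Require Import structures.
From mathcomp Require Import all_boot finmap zify.
From mathcomp Require Import boolp classical_sets functions cardinality.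
Local Open Scope classical_set_scope.
Local Open Scope card_scope.

Lemma card_eq_IID1 (T : choiceType) (A : set T) (x : T) (k : nat) :
  A #= `I_k -> A x -> A `\ x #= `I_(k - 1).
Proof.
move=> Ak Ax.
have finA : finite_set A by apply/finite_setP; exists k.
have finD : finite_set (A `\ x) by apply: sub_finite_set finA => y [].
rewrite -(fset_setK finD); apply/card_eq_fsetP.
rewrite fset_setD1 // -(card_fset_set Ak) (cardfsD1 x (fset_set A)) in_fset_set // mem_set //.
by rewrite add1n subn1.
Qed.

Lemma subset_card_II_eq (T : choiceType) (A B : set T) (a b : nat) :
  A #= `I_a -> B #= `I_b -> A `<=` B -> b <= a -> A = B.
Proof.
move=> Aa Bb AB ba; apply/seteqP; split=> // y By; apply: contrapT => nAy.
(* Positivity of [b] makes the truncated [b - 1] strictly smaller than [b]; removing [y] from [B]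
   then leaves too little room for [A]. *)
have b0 : 0 < b.
  rewrite lt0n; apply/eqP => b0; move: Bb; rewrite b0 II0 card_eq0.
  by move=> /eqP B0; rewrite B0 in By.
have : A #<= B `\ y.
  by apply: subset_card_le => z Az; split; [exact: AB | move=> zy; rewrite -zy in nAy].
rewrite (card_le_eqr (card_eq_IID1 _ _ _ _ Bb By)) (card_le_eql Aa) card_le_II.
by move=> /(leq_trans ba); rewrite leqNgt subn1 ltn_predL b0.
Qed.

Lemma spowS (S : semigroupType) (x : S) (m : nat) :
  0 < m -> spow x m.+1 = mul x (spow x m).
Proof. by case: m. Qed.

Lemma spowD (S : semigroupType) (x : S) (a b : nat) :
  0 < a -> 0 < b -> spow x (a + b) = mul (spow x a) (spow x b).
Proof.
move=> a0 b0; elim: a a0 => // -[_ _|a IH _]; first by rewrite add1n spowS.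
by rewrite addSn spowS // IH // mulgA -spowS.
Qed.

Lemma spowM (S : semigroupType) (x : S) (a b : nat) :
  0 < a -> 0 < b -> spow (spow x a) b = spow x (a * b).
Proof.
move=> a0; elim: b => // -[_ _|b IH _]; first by rewrite muln1.
by rewrite spowS // IH // (mulnS a b.+1) spowD // muln_gt0 a0.
Qed.

Lemma cyc_refl (S : semigroupType) (x : S) : cyc x x.
Proof. by exists 1. Qed.

Lemma cyc_sub (S : semigroupType) (x z : S) : cyc z x -> cyc x `<=` cyc z.
Proof.
move=> [a /= a0 <-] _ [b /= b0 <-]; rewrite spowM //.
by exists (a * b) => //=; rewrite muln_gt0 a0.
Qed.

(** A monogenic subsemigroup through [a] contains all powers of [a], so maximality of [cyc a] leaves
    no room for a proper inclusion. *)
Lemma maxgen_eq (S : semigroupType) (a z : S) :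
  maxgen S a -> cyc z a -> cyc z = cyc a.
Proof.
move=> [_ amax] za; apply: contrapT => ne.
apply: (amax (cyc z)); first by exists z.
by rewrite properEneq; split; [apply/eqP => /esym | exact: cyc_sub].
Qed.

Lemma epg_cyc_sub_neighbours (S : semigroupType) (x a : S) :
  cyc a x -> cyc a `\ x `<=` neighbours (enhanced_power_graph S) x.
Proof. by move=> ax y [ay yx]; split; [exact/nesym | exists a]. Qed.

Lemma epg_neighbours_maxgen (S : semigroupType) (a : S) :
  maxgen S a -> neighbours (enhanced_power_graph S) a = cyc a `\ a.
Proof.
move=> aM; apply/seteqP; split; last exact/epg_cyc_sub_neighbours/cyc_refl.
move=> y [ay [z [za zy]]].
by split; [rewrite -(maxgen_eq _ _ _ aM za) | exact/nesym].
Qed.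

Section BoundedExponent.
Variables (S : semigroupType) (n : nat).
Hypothesis n_gt0 : 0 < n.
Hypothesis spow_idem : forall x : S, idempotent_elt (spow x n).

(** Idempotency of [spow x n] lets any exponent above [2 * n] be lowered by [n], and strong
    induction brings it into range. Index 0 only contributes the junk value [x]. *)
Lemma cyc_sub_powers (x : S) : cyc x `<=` spow x @` `I_(2 * n).+1.
Proof.
move=> _ [m /= m0 <-]; elim/ltn_ind: m m0 => m IH m0.
have [mn|nm] := ltnP m (2 * n).+1; first by exists m.
have -> : spow x m = spow x (m - n).
  (* The remainder must be positive because [spowD] fails for the junk exponent 0; hence the bound
     [2 * n]. *)
  have d0 : 0 < m - 2 * n by rewrite subn_gt0.
  have -> : m - n = n + (m - 2 * n) by lia.
  have {1}-> : m = n + n + (m - 2 * n) by lia.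
  by rewrite !spowD ?addn_gt0 ?n_gt0 // spow_idem.
by apply: IH; lia.
Qed.

Lemma cyc_card_le (x : S) : cyc x #<= `I_(2 * n).+1.
Proof.
apply: card_le_trans (card_image_le _ _).
exact/subset_card_le/cyc_sub_powers.
Qed.

Lemma cyc_card (x : S) : exists k, cyc x #= `I_k.
Proof.
by apply/finite_setP; apply: card_le_finite (cyc_card_le x) (finite_II _).
Qed.

(** Take a largest [cyc a] containing [x]. A monogenic set [cyc b] above it also contains [x], so it
    is no larger and equals [cyc a]. *)
Lemma ex_maxgen (x : S) : exists2 a, maxgen S a & cyc a x.
Proof.
pose P k := `[< exists2 z, cyc z x & cyc z #= `I_k >].
have exP : exists k, P k.
  by have [k xk] := cyc_card x; exists k; apply/asboolP; exists x => //; exact: cyc_refl.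
have leP k : P k -> k <= (2 * n).+1.
  move=> /asboolP[z _ zk]; rewrite -card_le_II -(card_le_eql zk).
  exact: cyc_card_le.
case: (ex_maxnP exP leP) => k /asboolP[a ax ak] kmax; exists a => //.
split; first by exists a.
move=> _ [b ->]; rewrite properEneq => -[/eqP ne ab]; apply: ne.
have [l bl] := cyc_card b.
apply: (subset_card_II_eq _ _ _ _ _ ak bl ab); apply: kmax.
by apply/asboolP; exists b => //; exact: ab.
Qed.

Lemma min_order_degree : [set: S] !=set0 ->
  exists m : nat,
    is_min_card [set cyc x | x in maxgen S] `I_m /\
    is_min_degree (enhanced_power_graph S) `I_(m - 1).
Proof.
move=> [x0 _].
pose P k := `[< exists2 a, maxgen S a & cyc a #= `I_k >].
have exP : exists k, P k.
  have [a aM _] := ex_maxgen x0; have [k ak] := cyc_card a.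
  by exists k; apply/asboolP; exists a.
case: (ex_minnP exP) => m /asboolP[a aM am] mmin; exists m; split; split.
- by exists (cyc a) => //; exists a.
- move=> _ [b bM <-]; have [k bk] := cyc_card b.
  by rewrite (card_le_eqr bk) card_le_II mmin //; apply/asboolP; exists b.
- exists (cyc a `\ a); first by exists a => //; exact: epg_neighbours_maxgen.
  by apply: card_eq_IID1 => //; exact: cyc_refl.
(* An arbitrary [x] is adjacent to every other point of some maximal [cyc b], so its degree is at
   least [k - 1], where [k] is the order of [b] and [m <= k]. *)
- move=> _ [x _ <-]; have [b bM bx] := ex_maxgen x; have [k bk] := cyc_card b.
  apply: card_le_trans (subset_card_le (epg_cyc_sub_neighbours _ _ _ bx)).
  rewrite (card_le_eqr (card_eq_IID1 _ _ _ _ bk bx)) card_le_II leq_sub2r //.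
  by apply: mmin; apply/asboolP; exists b.
Qed.

Lemma independence_number_maximal_monogenic : [set: S] !=set0 ->
  is_independence_number (enhanced_power_graph S)
    [set A : set S | maximal_monogenic A].
Proof.
move=> [x0 _]; split.
(* [gen] picks one generator of each maximal set; [x0] is a default value elsewhere. *)
- have /choice[gen genE] (A : set S) :
      exists a, maximal_monogenic A -> A = cyc a.
    have [[[a ->] _]|nA] := pselect (maximal_monogenic A); first by exists a.
    by exists x0.
  exists (gen @` [set A : set S | maximal_monogenic A]).
  (* If [gen A] and [gen B] were adjacent through [z], then [cyc z] would equal both [A] and [B]. *)
  + move=> _ _ [A /= AM <-] [B /= BM <-] AB [_ [z [zA zB]]]; apply: AB.
    have gA : maxgen S (gen A) by rewrite /maxgen /= -genE.
    have gB : maxgen S (gen B) by rewrite /maxgen /= -genE.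
    by rewrite (genE _ AM) (genE _ BM) -(maxgen_eq _ _ _ gA zA) (maxgen_eq _ _ _ gB zB).
  + apply: inj_card_eq => A B /set_mem/= AM /set_mem/= BM AB.
    by rewrite (genE _ AM) (genE _ BM) AB.
- move=> A indA.
  have /choice[f fP] (x : S) : exists B, maximal_monogenic B /\ B x.
    by have [a aM ax] := ex_maxgen x; exists (cyc a).
  (* Distinct points of [A] sent to the same maximal set would be adjacent through its generator. *)
  have finj : {in A &, injective f}.
    move=> x y /set_mem Ax /set_mem Ay fxy; apply: contrapT => xy.
    apply: (indA x y Ax Ay xy); split=> //.
    have [[[z fxE] _] fx] := fP x; have [_ fy] := fP y.
    by exists z; rewrite -fxE; split=> //; rewrite fxy.
  rewrite -(card_le_eql (inj_card_eq finj)).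
  by apply: subset_card_le => _ [x _ <-]; case: (fP x).
Qed.

End BoundedExponent.

Theorem theorem3p23 (S : semigroupType) (n : nat)
    (S_nonempty : [set: S] !=set0) (S_exp : has_exponent S n) :
  (exists m : nat,
     is_min_card [set cyc x | x in maxgen S] `I_m /\
     is_min_degree (enhanced_power_graph S) `I_(m - 1)) /\
  is_independence_number (enhanced_power_graph S)
    [set A : set S | maximal_monogenic A].
Proof.
have [n_gt0 spow_idem _] := S_exp; split.
- exact: (min_order_degree S n n_gt0 spow_idem).
- exact: (independence_number_maximal_monogenic S n n_gt0 spow_idem).
Qed.
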